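(* Minimum Bipartite Edge Cover reduces in linear time to SCSS$_3$: there is a linear-time procedure that, given a bipartite graph $B$, constructs a strongly connected digraph $D$ in which every directed cycle has at most three edges, such that edge covers of $B$ correspond to strongly connected spanning subgraphs of $D$ (and vice versa) with sizes differing by a fixed additive amount, so that a minimum edge cover of $B$ is obtained from a minimum SCSS of $D$.
   Context: An edge cover of an undirected graph is a set of edges such that every vertex is incident to at least one edge of the set; Minimum Bipartite Edge Cover asks for a minimum-size edge cover of a given bipartite graph. For a strongly connected digraph $G=(V,E)$, a strongly connected spanning subgraph (SCSS) is a subset $S\subseteq E$ with $(V,S)$ strongly connected. SCSS$_3$ is the problem of finding a minimum-size SCSS in a strongly connected digraph in which every directed cycle has at most three edges. *)

(* Defs.v *)
(* MathComp world (boot only) *)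
From mathcomp Require Import all_boot.

Set Implicit Arguments.
Unset Strict Implicit.
Unset Printing Implicit Defensive.

(** * Random access machine

    Unit-cost RAM over natural numbers with structured control.  A program
    mentions finitely many registers and finitely many arrays, all addressed by
    literal indices; array cells are addressed indirectly.  The only arithmetic
    is successor and predecessor, so during a run of length [t] every number is
    bounded by the largest number in the input or in the program text plus [t]:
    unit cost is never charged for operations on long words. *)

Record state := State { reg : nat -> nat; arr : nat -> nat -> nat }.

Inductive cmd : Type :=
  | Const of nat & nat               (* r_x := k *)
  | Copy of nat & nat                (* r_x := r_y *)
  | Succ of nat & nat                (* r_x := r_y + 1 *)
  | Pred of nat & nat                (* r_x := r_y - 1, truncated at 0 *)
  | Get of nat & nat & nat           (* r_x := a[r_y], arguments x a y *)
  | Put of nat & nat & nat           (* a[r_x] := r_y, arguments a x y *)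
  | Seq of cmd & cmd
  | IfLt of nat & nat & cmd & cmd    (* if r_x < r_y then _ else _ *)
  | WhileLt of nat & nat & cmd.      (* while r_x < r_y do _ *)

Definition set_reg (st : state) (x v : nat) : state :=
  State (fun y => if y == x then v else reg st y) (arr st).

Definition set_arr (st : state) (a i v : nat) : state :=
  State (reg st)
    (fun b j => if (b == a) && (j == i) then v else arr st b j).

(** [exec c st st' t]: started in [st], the program [c] halts in [st'] after
    exactly [t] steps (assignments and evaluated tests). *)
Inductive exec : cmd -> state -> state -> nat -> Prop :=
  | ExecConst x k st : exec (Const x k) st (set_reg st x k) 1
  | ExecCopy x y st : exec (Copy x y) st (set_reg st x (reg st y)) 1
  | ExecSucc x y st : exec (Succ x y) st (set_reg st x (reg st y).+1) 1
  | ExecPred x y st : exec (Pred x y) st (set_reg st x (reg st y).-1) 1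
  | ExecGet x a y st :
      exec (Get x a y) st (set_reg st x (arr st a (reg st y))) 1
  | ExecPut a x y st :
      exec (Put a x y) st (set_arr st a (reg st x) (reg st y)) 1
  | ExecSeq c1 c2 st st1 st2 t1 t2 :
      exec c1 st st1 t1 -> exec c2 st1 st2 t2 ->
      exec (Seq c1 c2) st st2 (t1 + t2)
  | ExecIfLt x y c1 c2 st st' t :
      exec (if reg st x < reg st y then c1 else c2) st st' t ->
      exec (IfLt x y c1 c2) st st' t.+1
  | ExecWhileLt_done x y c st :
      reg st y <= reg st x -> exec (WhileLt x y c) st st 1
  | ExecWhileLt_loop x y c st st1 st2 t1 t2 :
      reg st x < reg st y ->
      exec c st st1 t1 -> exec (WhileLt x y c) st1 st2 t2 ->
      exec (WhileLt x y c) st st2 (t1 + t2).+1.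

Definition exec_within (c : cmd) (st st' : state) (b : nat) : Prop :=
  exists2 t, exec c st st' t & t <= b.

(** * Undirected graphs on ['I_n], given by their sets of edges *)

Section Undirected.
Variable n : nat.
Implicit Types (E C : {set {set 'I_n}}) (s : seq ('I_n * 'I_n)).

(** Every edge is a pair of (distinct) vertices on different sides. *)
Definition bipartite E : Prop :=
  exists U : {set 'I_n}, forall e, e \in E ->
    exists u w, [/\ u \in U, w \notin U & e = [set u; w]].

Definition edge_cover E C : Prop :=
  C \subset E /\ forall v : 'I_n, exists2 e, e \in C & v \in e.

Definition min_edge_cover E C : Prop :=
  edge_cover E C /\ forall C', edge_cover E C' -> #|C| <= #|C'|.

(** [s] lists every edge of [E] exactly once, in any order and with its two
    endpoints in either order. *)
Definition edge_list E s : Prop :=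
  uniq [seq [set p.1; p.2] | p <- s] /\
  E = [set e in [seq [set p.1; p.2] | p <- s]].

End Undirected.

(** * Digraphs on ['I_n], given by their sets of arcs *)

Section Directed.
Variable n : nat.
Implicit Types (A S : {set 'I_n * 'I_n}) (s : seq ('I_n * 'I_n)).

Definition arc A : rel 'I_n := [rel u v | (u, v) \in A].

Definition loopless A : Prop := forall u, (u, u) \notin A.

Definition strongly_connected A : Prop := forall u v, connect (arc A) u v.

(** A directed cycle is the cyclic sequence [p] of its distinct vertices, so
    that [size p] is also its number of arcs. *)
Definition cycles_le (k : nat) A : Prop :=
  forall p : seq 'I_n, ucycle (arc A) p -> size p <= k.

Definition scss A S : Prop := S \subset A /\ strongly_connected S.

Definition min_scss A S : Prop :=
  scss A S /\ forall S', scss A S' -> #|S| <= #|S'|.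

Definition arc_list A s : Prop := uniq s /\ A = [set p in s].

End Directed.

(** * Graphs in memory *)

Definition code (n : nat) (s : seq ('I_n * 'I_n)) : seq (nat * nat) :=
  [seq (val p.1, val p.2) | p <- s].

(** Initial memory for an input consisting of a vertex count [n] and two lists
    of pairs [s] and [l] (the latter empty when there is only one).  [n],
    [size s] and [size l] are in registers 0, 1, 2; the first and second
    components of [s] are in arrays 0 and 1, those of [l] in arrays 2 and 3.
    Everything else is 0. *)
Definition init (n : nat) (s l : seq (nat * nat)) : state :=
  State (nth 0 [:: n; size s; size l])
        (fun a i => match a with
           | 0 => (nth (0, 0) s i).1
           | 1 => (nth (0, 0) s i).2
           | 2 => (nth (0, 0) l i).1
           | 3 => (nth (0, 0) l i).2
           | _ => 0
           end).

(** Output convention for a list of pairs; cells beyond the list are free. *)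
Definition outputs (st : state) (s : seq (nat * nat)) : Prop :=
  reg st 1 = size s /\
  forall i, i < size s -> (arr st 0 i, arr st 1 i) = nth (0, 0) s i.

(* Main.v *)
(** Orient every edge of [B] from one side [U] of a bipartition to the other and
    add a hub with arcs to every vertex of [U] and from every other vertex.
    Away from the hub all paths have one arc, so every cycle is a triangle
    through the hub.  A vertex of [U] has no in-arc but the one from the hub, and
    any other vertex no out-arc but the one to the hub, so every SCSS contains
    all [n] hub arcs; the other arcs of [S] then make it strongly connected iff
    they leave every vertex of [U] and enter every other vertex, i.e. form an
    edge cover.

    A bipartition is found in linear time by a depth-first search whose invariant
    is that the current partial colouring extends to a proper 2-colouring. *)

Require Import Defs.
From mathcomp Require Import all_boot.
From mathcomp Require Import zify.

Set Implicit Arguments.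
Unset Strict Implicit.
Unset Printing Implicit Defensive.

(** * The digraph *)

Lemma pair_inj (T T' : Type) (p q : T * T') :
  p = q -> p.1 = q.1 /\ p.2 = q.2.
Proof. by move=> ->. Qed.

(** Generic in [T] because it acts both on vertices in ['I_n] and on their codes in [nat]. *)
Definition orient (T : Type) (b : pred T) (p : T * T) : T * T :=
  if b p.1 then p else (p.2, p.1).

Section HubDigraph.
Variables (n : nat) (b : pred 'I_n).
Implicit Types (E C : {set {set 'I_n}}) (S : {set 'I_n.+1 * 'I_n.+1}).
Implicit Types (u v w : 'I_n) (p q : 'I_n * 'I_n).

(** The hub is the last vertex, so that [lift hub] preserves numerical values and the programs need
    no renumbering. *)
Let hub : 'I_n.+1 := ord_max.

Definition ends p : {set 'I_n} := [set p.1; p.2].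
Definition emb p : 'I_n.+1 * 'I_n.+1 := (lift hub p.1, lift hub p.2).
Definition spoke v : 'I_n.+1 * 'I_n.+1 :=
  if b v then (hub, lift hub v) else (lift hub v, hub).

Definition forward p := b p.1 && ~~ b p.2.

(** One construction serves twice: at [E] it is the whole digraph, at an edge cover [C] the
    corresponding spanning subgraph. *)
Definition cover_arcs C : {set 'I_n.+1 * 'I_n.+1} :=
  [set spoke v | v in 'I_n] :|: [set emb p | p in forward & ends p \in C].

Definition arc_edges S : {set {set 'I_n}} :=
  [set ends p | p in forward & emb p \in S].

Definition bicoloured E :=
  forall e, e \in E -> exists2 p, forward p & e = ends p.

Lemma emb_inj : injective emb.
Proof.
case=> u w [u' w'] eq_p; have [eu ew] := pair_inj eq_p.
by congr (_, _); [exact: lift_inj eu | exact: lift_inj ew].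
Qed.

Lemma spoke_inj : injective spoke.
Proof.
move=> u v; rewrite /spoke; case: ifP => bu; case: ifP => bv /pair_inj[] /=.
- by move=> _ /lift_inj.
- by move=> /eqP; rewrite (negPf (neq_lift _ _)).
- by move=> /eqP; rewrite eq_sym (negPf (neq_lift _ _)).
- by move/lift_inj.
Qed.

(** An edge has at most one forward orientation, since [b] tells its endpoints apart. *)
Lemma ends_inj : {in forward &, injective ends}.
Proof.
move=> [u w] [u' w'] /andP[/= bu bw] /andP[/= bu' bw'] eq_e.
have: u \in ends (u', w') by rewrite -eq_e set21.
have: w \in ends (u', w') by rewrite -eq_e set22.
rewrite !in_set2 => /orP[]/eqP ew /orP[]/eqP eu; subst => //.
- by rewrite bu' in bw.
- by rewrite bu' in bw.
- by rewrite bu in bw'.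
Qed.

Lemma emb_neq_spoke p v : emb p != spoke v.
Proof.
rewrite /emb /spoke; case: ifP => _; rewrite xpair_eqE negb_and.
  by rewrite eq_sym neq_lift.
by rewrite orbC eq_sym neq_lift.
Qed.

Lemma spoke_cover_arcs C v : spoke v \in cover_arcs C.
Proof. by rewrite inE imset_f. Qed.

Lemma emb_cover_arcs C p :
  (emb p \in cover_arcs C) = forward p && (ends p \in C).
Proof.
rewrite inE; apply/orP/idP => [[]/imsetP[q]|fp].
- by move=> _ eq_p; case/negP: (emb_neq_spoke p q); apply/eqP.
- by rewrite inE => fq /emb_inj->.
- by right; apply: imset_f; rewrite inE.
Qed.

Lemma cover_arcsP C x y : (x, y) \in cover_arcs C ->
  [\/ exists u, [/\ b u, x = hub & y = lift hub u],
      exists w, [/\ ~~ b w, x = lift hub w & y = hub] |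
      exists p, [/\ forward p, ends p \in C, x = lift hub p.1 & y = lift hub p.2]].
Proof.
rewrite inE => /orP[]/imsetP[].
  move=> v _; rewrite /spoke; case: ifPn => bv /pair_inj[/= -> ->].
    by constructor 1; exists v.
  by constructor 2; exists v.
move=> p; rewrite inE => /andP[fp pC] def_xy.
by have [/= -> ->] := pair_inj def_xy; constructor 3; exists p.
Qed.

Lemma cover_arcsS C C' : C \subset C' -> cover_arcs C \subset cover_arcs C'.
Proof.
move=> sCC'; apply: setUS; apply: imsetS; apply/subsetP => p; rewrite !inE.
by case/andP=> -> /(subsetP sCC').
Qed.

Lemma cover_arcs_loopless C : loopless (cover_arcs C).
Proof.
move=> x; apply/negP => /cover_arcsP[[u [_]]|[w [_]]|[[u w] [/andP[/= bu bw] _]]].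
- by move=> -> /eqP; rewrite (negPf (neq_lift _ _)).
- by move=> -> /eqP; rewrite eq_sym (negPf (neq_lift _ _)).
- by move=> -> /lift_inj /= eq_uw; rewrite -eq_uw bu in bw.
Qed.

(** An arc between non-hub vertices starts where [b] holds and ends where [b] fails, so two such
    arcs cannot be consecutive. *)
Lemma cover_arcs_path C x y z : (x, y) \in cover_arcs C ->
  (y, z) \in cover_arcs C -> [|| x == hub, y == hub | z == hub].
Proof.
move=> /cover_arcsP[[u [_ -> _]]|[w [_ _ ->]]|[p [/andP[_ bp] _ _ ey]]];
  rewrite ?eqxx ?orbT //.
move=> /cover_arcsP[[u [_ -> _]]|[w [_ _ ->]]|[q [/andP[bq _] _ ey' _]]];
  rewrite ?eqxx ?orbT //.
by move: ey'; rewrite ey => /lift_inj eq_pq; rewrite eq_pq bq in bp.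
Qed.

Lemma cover_arcs_cycles C : cycles_le 3 (cover_arcs C).
Proof.
(* A cycle with four vertices or more, read from the hub if it meets it, has a
   hub-free path with two arcs. *)
have hub_free x1 x2 x3 x4 r : ucycle (Defs.arc (cover_arcs C)) [:: x1, x2, x3, x4 & r] ->
    hub \in [:: x2, x3, x4 & r].
  case/andP=> /and4P[_ e2 e3 _] _; rewrite !inE.
  by case/or3P: (cover_arcs_path e2 e3) => /eqP->; rewrite eqxx ?orbT.
move=> p cp; rewrite leqNgt; apply/negP => lt_p.
have [hp|hNp] := boolP (hub \in p); last first.
  case: p lt_p cp hNp => [|x1 [|x2 [|x3 [|x4 r]]]] // _ /hub_free.
  by rewrite (in_cons x1) => ->; rewrite orbT.
have [i q def_q] := rot_to hp.
have: ucycle (Defs.arc (cover_arcs C)) (hub :: q) by rewrite -def_q rot_ucycle.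
have: size (hub :: q) = size p by rewrite -def_q size_rot.
case: q {def_q} => [|x2 [|x3 [|x4 r]]]; try by move=> sz; rewrite -sz in lt_p.
move=> _ cq; have := hub_free _ _ _ _ _ cq.
by case/andP: cq => _ /andP[/negPf-> _].
Qed.

Lemma connect_out (T : finType) (e : rel T) x y :
  connect e x y -> x != y -> exists z, e x z.
Proof.
case/connectP=> [[|z p]] /=; first by move=> _ ->; rewrite eqxx.
by case/andP=> exz _ _ _; exists z.
Qed.

Lemma connect_in (T : finType) (e : rel T) x y :
  connect e x y -> x != y -> exists z, e z y.
Proof.
rewrite eq_sym => cxy; apply: (@connect_out _ [rel u v | e v u] y x).
by rewrite connect_rev.
Qed.

(** * Edge covers versus strongly connected spanning subgraphs *)

Section Correspondence.
Variable E : {set {set 'I_n}}.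
Hypothesis colE : bicoloured E.

(** The [n] spokes are disjoint from the embedded arcs, and each edge of [C] has exactly one forward
    orientation. *)
Lemma card_cover_arcs C : C \subset E -> #|cover_arcs C| = #|C| + n.
Proof.
move=> sCE; rewrite cardsU disjoint_setI0 ?cards0 ?subn0; last first.
  apply/pred0P => x /=; apply/negP => /andP[/imsetP[v _ ->] /imsetP[p _]].
  by move/esym/eqP; rewrite (negPf (emb_neq_spoke p v)).
rewrite card_imset ?card_ord; last exact: spoke_inj.
rewrite card_imset; last exact: emb_inj.
rewrite addnC; congr (_ + _).
have def_C: C = ends @: [set p in forward | ends p \in C].
  apply/setP => e; apply/idP/imsetP => [eC|[p]].
    have [p fp def_e] := colE (subsetP sCE e eC).
    by exists p => //; rewrite inE -def_e eC andbT.
  by rewrite inE => /andP[_ pC] ->.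
rewrite [in RHS]def_C card_in_imset // => p q.
by rewrite !inE => /andP[fp _] /andP[fq _]; apply: ends_inj.
Qed.

Lemma cover_arcsK C : C \subset E -> arc_edges (cover_arcs C) = C.
Proof.
move=> sCE; apply/setP => e; apply/imsetP/idP => [[p]|eC].
  by rewrite inE emb_cover_arcs => /and3P[_ _ pC] ->.
have [p fp def_e] := colE (subsetP sCE e eC).
by exists p => //; rewrite inE emb_cover_arcs -def_e eC andbT; apply/andP.
Qed.

Lemma edge_cover_arc C v : edge_cover E C ->
  exists2 p, (forward p && (ends p \in C)) & if b v then p.1 = v else p.2 = v.
Proof.
move=> [sCE /(_ v)[e eC ve]]; have [p fp def_e] := colE (subsetP sCE e eC).
exists p; first by rewrite fp -def_e.
move: ve; rewrite def_e in_set2; case/andP: fp => b1 b2.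
by case/orP=> /eqP->; rewrite ?b1 // (negPf b2).
Qed.

Lemma cover_scss C : edge_cover E C -> scss (cover_arcs E) (cover_arcs C).
Proof.
move=> covC; split; first exact: cover_arcsS covC.1.
have hub_to u : b u -> Defs.arc (cover_arcs C) hub (lift hub u).
  by move=> bu; have := spoke_cover_arcs C u; rewrite /spoke bu.
have to_hub w : ~~ b w -> Defs.arc (cover_arcs C) (lift hub w) hub.
  by move=> bw; have := spoke_cover_arcs C w; rewrite /spoke (negPf bw).
have viaP p : forward p && (ends p \in C) ->
    Defs.arc (cover_arcs C) (lift hub p.1) (lift hub p.2).
  by rewrite -emb_cover_arcs.
(* It suffices to join every vertex to the hub both ways. One way is its spoke; the other is a
   covering arc at the vertex combined with the spoke at the far end of that arc. *)
have hubP x :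
    connect (Defs.arc (cover_arcs C)) hub x /\ connect (Defs.arc (cover_arcs C)) x hub.
  case: (unliftP hub x) => [v|] -> //.
  have [[u w] uwC] := edge_cover_arc v covC.
  have /andP[/andP[/= bu bw] _] := uwC.
  case: ifPn => bv /= eq_v; subst; split.
  - exact: connect1 (hub_to v bv).
  - exact: connect_trans (connect1 (viaP _ uwC)) (connect1 (to_hub _ bw)).
  - exact: connect_trans (connect1 (hub_to _ bu)) (connect1 (viaP _ uwC)).
  - exact: connect1 (to_hub v bv).
by move=> x y; apply: (connect_trans (hubP x).2 (hubP y).1).
Qed.

Lemma scss_in S v : scss (cover_arcs E) S -> exists x, (x, lift hub v) \in S.
Proof. by move=> [_ scS]; apply: (connect_in (scS hub _)); rewrite neq_lift. Qed.

Lemma scss_out S v : scss (cover_arcs E) S -> exists x, (lift hub v, x) \in S.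
Proof.
by move=> [_ scS]; apply: (connect_out (scS _ hub)); rewrite eq_sym neq_lift.
Qed.

Lemma lift_hub v : (lift hub v == hub) = false.
Proof. by rewrite eq_sym (negPf (neq_lift _ _)). Qed.

(** The spoke is the only arc into [v] if [b v] holds and the only arc out of [v] otherwise, while
    strong connectivity forces an arc each way. *)
Lemma scss_spoke S v : scss (cover_arcs E) S -> spoke v \in S.
Proof.
move=> sS; have sub := subsetP sS.1; rewrite /spoke; case: ifPn => bv.
  have [x xS] := scss_in v sS.
  case/cover_arcsP: (sub _ xS) => [[u [_ def_x _]]|[w [_ _ /eqP]]|[p [/andP[_ bp] _ _]]].
  - by move: xS; rewrite def_x.
  - by rewrite lift_hub.
  by move/lift_inj => eq_v; rewrite -eq_v bv in bp.
have [x xS] := scss_out v sS.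
case/cover_arcsP: (sub _ xS) => [[u [_ /eqP]]|[w [_ _ def_x]]|[p [/andP[bp _] _]]].
- by rewrite lift_hub.
- by move: xS; rewrite def_x.
by move=> /lift_inj eq_v; rewrite eq_v bp in bv.
Qed.

(** The spoke of a vertex serves one direction only; the arc needed in the other direction must come
    from an edge. *)
Lemma scss_edge_cover S : scss (cover_arcs E) S -> edge_cover E (arc_edges S).
Proof.
move=> sS; have sub := subsetP sS.1; split.
  apply/subsetP => e /imsetP[p]; rewrite inE => /andP[_ /sub].
  by rewrite emb_cover_arcs => /andP[_ pE] ->.
move=> v; have [bv|bv] := boolP (b v).
  have [x xS] := scss_out v sS.
  case/cover_arcsP: (sub _ xS) => [[u [_ /eqP]]|[w [bw /lift_inj eq_v _]]|[p [fp _ vp def_x]]].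
  - by rewrite lift_hub.
  - by rewrite -eq_v bv in bw.
  exists (ends p); last by rewrite (lift_inj vp) set21.
  by apply: imset_f; rewrite inE /emb -vp -def_x xS andbT.
have [x xS] := scss_in v sS.
case/cover_arcsP: (sub _ xS) => [[u [bu _ /lift_inj eq_v]]|[w [_ _ /eqP]]|[p [fp _ def_x vp]]].
- by rewrite eq_v bu in bv.
- by rewrite lift_hub.
exists (ends p); last by rewrite (lift_inj vp) set22.
by apply: imset_f; rewrite inE /emb -vp -def_x xS andbT.
Qed.

Lemma arc_edgesK S : scss (cover_arcs E) S -> cover_arcs (arc_edges S) = S.
Proof.
move=> sS; have sub := subsetP sS.1; apply/setP => x; apply/idP/idP.
  rewrite inE => /orP[]/imsetP[]; first by move=> v _ ->; apply: scss_spoke.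
  move=> p; rewrite inE => /andP[fp /imsetP[q]]; rewrite inE => /andP[fq qS].
  by move/(ends_inj fp fq)=> -> ->.
move=> xS; have := sub x xS; rewrite inE => /orP[]/imsetP[].
  by move=> v _ ->; apply: spoke_cover_arcs.
move=> p; rewrite inE => /andP[fp _] def_x; rewrite def_x emb_cover_arcs.
apply/andP; split=> //.
by apply: imset_f; rewrite inE -def_x xS andbT.
Qed.

(** All sizes shift by the same [n], so minimality transfers through the bijection. *)
Lemma min_scss_edge_cover S :
  min_scss (cover_arcs E) S -> min_edge_cover E (arc_edges S).
Proof.
move=> [sS minS]; have cS := scss_edge_cover sS; split=> // C covC.
rewrite -(leq_add2r n) -card_cover_arcs ?cS.1 // arc_edgesK //.
by rewrite -card_cover_arcs ?covC.1 //; apply/minS/cover_scss.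
Qed.

(** Partial inverse of [emb], failing exactly on pairs that touch the hub; [pmap] with it drops the
    spokes from an arc list. *)
Definition unemb (q : 'I_n.+1 * 'I_n.+1) : option ('I_n * 'I_n) :=
  if (unlift hub q.1, unlift hub q.2) is (Some u, Some w) then Some (u, w)
  else None.

Lemma unembK : ocancel unemb emb.
Proof.
move=> [x y]; rewrite /unemb /emb /=.
by case: unliftP => [u ->|_] //=; case: unliftP => [w ->|_].
Qed.

Lemma embK : pcancel emb unemb.
Proof. by move=> [u w]; rewrite /unemb /emb /= !liftK. Qed.

Lemma arc_edges_list S l : scss (cover_arcs E) S -> arc_list S l ->
  edge_list (arc_edges S) (pmap unemb l).
Proof.
move=> sS [uniq_l def_S].
have mem_l p : (p \in pmap unemb l) = (emb p \in l).
  exact: (can2_mem_pmap unembK embK).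
have fwd p : emb p \in l -> forward p.
  move=> pl; have: emb p \in cover_arcs E by apply: (subsetP sS.1); rewrite def_S inE.
  by rewrite emb_cover_arcs => /andP[].
split; last first.
  apply/setP => e; rewrite inE; apply/imsetP/mapP => -[p].
    by rewrite inE def_S inE => /andP[_ pl] ->; exists p; rewrite ?mem_l.
  by rewrite mem_l => pl ->; exists p => //; rewrite inE def_S inE pl andbT; apply: fwd.
rewrite map_inj_in_uniq ?(pmap_uniq unembK) // => p q.
by rewrite !mem_l => /fwd fp /fwd fq; apply: ends_inj.
Qed.

(** The list follows the order in which the program writes: edges first, then spokes. *)
Lemma arc_list_cover_arcs (s : seq ('I_n * 'I_n)) :
  edge_list E s -> {in s, forall p, b p.1 != b p.2} ->
  arc_list (cover_arcs E)
    (map emb (map (orient b) s)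
     ++ map spoke (enum 'I_n)).
Proof.
set o := orient b; move=> [uniq_s def_E] col_s.
have ends_o p : ends (o p) = ends p.
  by rewrite /o /orient; case: ifP => // _; apply: setUC.
have fwd_o p : p \in s -> forward (o p).
  move/col_s; rewrite /o /orient /forward; case: ifP => /= bp; rewrite ?bp.
    by case: (b _).
  by case: (b _).
split.
  rewrite cat_uniq !(map_inj_uniq emb_inj, map_inj_uniq spoke_inj) enum_uniq andbT.
  apply/andP; split.
    apply: (@map_uniq _ _ ends); rewrite -map_comp.
    by rewrite (eq_map ends_o).
  apply/hasPn => x /mapP[v _ ->]; apply/negP => /mapP[p _ /esym/eqP].
  by rewrite (negPf (emb_neq_spoke p v)).
apply/setP => x; rewrite !inE mem_cat orbC; congr (_ || _).
  apply/imsetP/mapP => [[p]|[p /mapP[q qs ->] ->]].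
    rewrite inE def_E inE => /andP[fp /mapP[q qs eq_pq]] ->.
    exists p => //; apply/mapP; exists q => //.
    by apply: ends_inj; rewrite ?ends_o //; apply: fwd_o.
  exists (o q) => //; rewrite inE [_ \in forward]fwd_o //= ends_o def_E inE.
  exact: map_f.
apply/imsetP/mapP => -[v _ ->]; exists v => //; exact: mem_enum.
Qed.

End Correspondence.
End HubDigraph.

(** * Time-bounded execution *)

(** A total-correctness triple with a time bound. *)
Definition run (c : cmd) (st : state) (d : nat) (Q : state -> Prop) : Prop :=
  exists2 st', exec_within c st st' d & Q st'.

Lemma run_weaken c st d d' (Q Q' : state -> Prop) :
  run c st d Q -> d <= d' -> (forall st', Q st' -> Q' st') -> run c st d' Q'.
Proof.
move=> [st' [t et le_t] Qst] le_d QQ'; exists st'; last exact: QQ'.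
by exists t => //; apply: leq_trans le_d.
Qed.

Lemma run_seq c1 c2 st d1 d2 (Q1 Q2 : state -> Prop) :
  run c1 st d1 Q1 -> (forall st1, Q1 st1 -> run c2 st1 d2 Q2) ->
  run (Seq c1 c2) st (d1 + d2) Q2.
Proof.
move=> [st1 [t1 e1 le1] Q1st] /(_ _ Q1st)[st2 [t2 e2 le2] Q2st].
exists st2 => //; exists (t1 + t2); last exact: leq_add.
exact: ExecSeq e1 e2.
Qed.

Fixpoint loop_free (c : cmd) : bool :=
  match c with
  | Seq c1 c2 | IfLt _ _ c1 c2 => loop_free c1 && loop_free c2
  | WhileLt _ _ _ => false
  | _ => true
  end.

Fixpoint cost (c : cmd) : nat :=
  match c with
  | Seq c1 c2 => cost c1 + cost c2
  | IfLt _ _ c1 c2 => (maxn (cost c1) (cost c2)).+1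
  | _ => 1
  end.

(** On loop-free programs the semantics is a function, so loop bodies are handled by computation;
    the value at [WhileLt] is a dummy. *)
Fixpoint eval (c : cmd) (st : state) : state :=
  match c with
  | Const x k => set_reg st x k
  | Copy x y => set_reg st x (reg st y)
  | Succ x y => set_reg st x (reg st y).+1
  | Pred x y => set_reg st x (reg st y).-1
  | Get x a y => set_reg st x (arr st a (reg st y))
  | Put a x y => set_arr st a (reg st x) (reg st y)
  | Seq c1 c2 => eval c2 (eval c1 st)
  | IfLt x y c1 c2 => if reg st x < reg st y then eval c1 st else eval c2 st
  | WhileLt _ _ _ => st
  end.

Lemma exec_eval c st : loop_free c -> exec_within c st (eval c st) (cost c).
Proof.
elim: c st => //=; try by move=> *; eexists; [constructor|].
- move=> c1 IH1 c2 IH2 st /andP[/IH1 h1 /IH2 h2].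
  have [t1 e1 le1] := h1 st; have [t2 e2 le2] := h2 (eval c1 st).
  by exists (t1 + t2); [exact: ExecSeq e1 e2 | exact: leq_add].
- move=> x y c1 IH1 c2 IH2 st /andP[/IH1 h1 /IH2 h2].
  have [t1 e1 le1] := h1 st; have [t2 e2 le2] := h2 st.
  case: ifP => lt_xy.
    by exists t1.+1; [constructor; rewrite lt_xy | rewrite ltnS leq_max le1].
  by exists t2.+1; [constructor; rewrite lt_xy | rewrite ltnS leq_max le2 orbT].
Qed.

Lemma run_eval c st d (Q : state -> Prop) :
  loop_free c -> cost c <= d -> Q (eval c st) -> run c st d Q.
Proof.
move=> lc le_d Qst; exists (eval c st) => //.
by have [t et le_t] := exec_eval st lc; exists t => //; apply: leq_trans le_d.
Qed.

(** The index [k] is a potential that every iteration decreases, so it bounds their number. Each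
    iteration pays for its body and its test; the last unit pays for the final test. *)
Lemma run_while x y c (I : nat -> state -> Prop) : loop_free c ->
  (forall k st, I k st -> reg st x < reg st y ->
     exists2 k', k' < k & I k' (eval c st)) ->
  forall k st, I k st ->
  run (WhileLt x y c) st (k * (cost c).+1).+1
    (fun st' => reg st' y <= reg st' x /\ exists k', I k' st').
Proof.
move=> lc step k; have [r] := ubnP k; elim: r k => // r IH k.
rewrite ltnS => le_kr st Ik.
have [le_yx|lt_xy] := leqP (reg st y) (reg st x).
  exists st; last by split=> //; exists k.
  by exists 1; [exact: ExecWhileLt_done|].
have [k' lt_k Ik'] := step _ _ Ik lt_xy.
have [st' [t2 e2 le2] Qst'] := IH _ (leq_trans lt_k le_kr) _ Ik'.
have [t1 e1 le1] := exec_eval st lc.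
exists st' => //; exists (t1 + t2).+1; first exact: ExecWhileLt_loop e1 e2.
have: k'.+1 * (cost c).+1 <= k * (cost c).+1 by rewrite leq_mul2r lt_k orbT.
by rewrite mulSn; lia.
Qed.

Lemma run_for x y c m (J : nat -> state -> Prop) : loop_free c ->
  (forall i st, J i st -> reg st x = i /\ reg st y = m) ->
  (forall i st, i < m -> J i st -> J i.+1 (eval c st)) ->
  forall st, J 0 st -> run (WhileLt x y c) st (m * (cost c).+1).+1 (J m).
Proof.
move=> lc Jxy step st J0.
pose I k st := exists i, [/\ i <= m, k = m - i & J i st].
have Istep k st1 : I k st1 -> reg st1 x < reg st1 y ->
    exists2 k', k' < k & I k' (eval c st1).
  move=> [i [le_i -> Ji]]; have [-> ->] := Jxy _ _ Ji => lt_i.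
  by exists (m - i.+1); [lia | exists i.+1; split=> //; apply: step].
have I0 : I m st by exists 0; rewrite subn0.
apply: run_weaken (run_while lc Istep I0) (leqnn _) _.
move=> st' [le_yx [k [i [le_i _ Ji]]]].
have [ex ey] := Jxy _ _ Ji; rewrite ex ey in le_yx.
by have ->: m = i by lia.
Qed.

(** * Output lists, linked lists and the stack in memory *)

Definition skip := Const 7 0.

(** Register 1 is both the next write position and the length that [outputs] requires. *)
Definition emit x y := Seq (Put 0 1 x) (Seq (Put 1 1 y) (Succ 1 1)).

Lemma outputs_emit x y st l :
  outputs st l -> outputs (eval (emit x y) st) (rcons l (reg st x, reg st y)).
Proof.
move=> [sz_l out_l]; split; first by rewrite size_rcons -sz_l.
move=> i; rewrite size_rcons ltnS nth_rcons /= sz_l => le_i.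
case: (ltngtP i (size l)) => [lt_i|lt_i|_ //]; first exact: out_l.
by rewrite leqNgt lt_i in le_i.
Qed.

(* Linked lists threaded through [nxt]: [p = 0] is the empty list, cells are
   numbered from 1 up to the last allocated one, [k]. *)
Fixpoint chain (k : nat) (nxt cont : nat -> nat) (p : nat) (l : seq nat) : Prop :=
  if l is w :: l' then
    [/\ 0 < p <= k, cont p = w & chain k nxt cont (nxt p) l']
  else p = 0.

Lemma chain_grow k k' nxt nxt' cont cont' p l : k <= k' ->
  (forall j, j <= k -> nxt' j = nxt j /\ cont' j = cont j) ->
  chain k nxt cont p l -> chain k' nxt' cont' p l.
Proof.
move=> le_k same; elim: l p => //= w l IH p [/andP[p0 pk] eq_w ch].
have [-> ->] := same _ pk; split=> //; last exact: IH.
by rewrite p0 (leq_trans pk).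
Qed.

Implicit Type L : nat -> seq nat.

(* Heads in array 4, links in array 5, contents in array 6, allocation counter
   in register 12. *)
Definition adj_lists (st : state) L : Prop :=
  forall v, chain (reg st 12) (arr st 5) (arr st 6) (arr st 4 v) (L v).

Definition link x y :=
  Seq (Succ 12 12) (Seq (Put 6 12 y) (Seq (Get 7 4 x) (Seq (Put 5 12 7) (Put 4 x 12)))).

Definition push L u w : nat -> seq nat :=
  fun v => if v == u then w :: L v else L v.

Definition pop L u : nat -> seq nat :=
  fun v => if v == u then behead (L v) else L v.

(** The new cell lies beyond all allocated ones, so existing chains stay intact. The side conditions
    keep [x] and [y] from being overwritten before [link] reads them. *)
Lemma adj_lists_link x y st L : x != 12 -> x != 7 -> y != 12 ->
  adj_lists st L ->
  adj_lists (eval (link x y) st) (push L (reg st x) (reg st y)).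
Proof.
move=> /negPf x12 /negPf x7 /negPf y12 repL v.
rewrite /= x12 x7 y12 /push.
have grow p l : chain (reg st 12) (arr st 5) (arr st 6) p l ->
  chain (reg st 12).+1
    (fun j => if j == (reg st 12).+1 then arr st 4 (reg st x) else arr st 5 j)
    (fun j => if j == (reg st 12).+1 then reg st y else arr st 6 j) p l.
  by apply: chain_grow => // j le_j; rewrite ltn_eqF.
by case: eqP => [->|_]; [split; rewrite /= ?eqxx ?leqnn //|]; apply: grow.
Qed.

Lemma sum_push n L u w : u < n ->
  \sum_(v < n) size (push L u w v) = (\sum_(v < n) size (L v)).+1.
Proof.
move=> lt_u; rewrite (bigD1 (Ordinal lt_u)) //= [in RHS](bigD1 (Ordinal lt_u)) //=.
rewrite /push eqxx /= -addSn; congr (_ + _); apply: eq_bigr => v.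
by rewrite -val_eqE /= => /negPf->.
Qed.

Lemma sum_pop n L u w l : u < n -> L u = w :: l ->
  \sum_(v < n) size (L v) = (\sum_(v < n) size (pop L u v)).+1.
Proof.
move=> lt_u Lu; rewrite -(sum_push _ w lt_u); apply: eq_bigr => v _.
by rewrite /push /pop; case: eqP => // ->; rewrite Lu.
Qed.

(** The head of [stk] is the top of the stack, kept in the highest occupied cell. *)
Fixpoint stack_at (a : nat -> nat) (stk : seq nat) : Prop :=
  if stk is v :: stk' then a (size stk') = v /\ stack_at a stk' else True.

Lemma stack_at_eq a a' stk : (forall j, j < size stk -> a' j = a j) ->
  stack_at a stk -> stack_at a' stk.
Proof.
elim: stk => //= v stk IH same [<- stk_a]; split; first by rewrite same.
by apply: IH => // j lt_j; apply: same; apply: ltnW.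
Qed.

Lemma stack_at_push a w stk :
  stack_at a stk ->
  stack_at (fun j => if j == size stk then w else a j) (w :: stk).
Proof.
move=> stk_a /=; rewrite eqxx; split=> //.
by apply: stack_at_eq stk_a => j lt_j; rewrite ltn_eqF.
Qed.

(** * The programs *)

(* Registers of [reduction]: 2 holds 0, 11 holds 1, 3 is the loop index, 8 the
   stack height, 9 the next root of the search.  Array 7 holds the colours (0
   for uncoloured vertices) and array 8 the stack.  A scanned adjacency list is
   consumed from its head. *)
Definition build_step :=
  Seq (Get 5 0 3) (Seq (Get 6 1 3)
    (Seq (link 5 6) (Seq (link 6 5) (Succ 3 3)))).

(** Depth-first search flattened into a single loop-free step: pop an exhausted vertex, or scan one
    neighbour of the top, or, when the stack is empty, try the next root. *)
Definition search_step :=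
  IfLt 2 8
    (Seq (Pred 7 8) (Seq (Get 5 8 7) (Seq (Get 4 4 5)
      (IfLt 2 4
        (Seq (Get 6 6 4) (Seq (Get 4 5 4) (Seq (Put 4 5 4) (Seq (Get 7 7 6)
          (IfLt 2 7 skip
            (Seq (Get 7 7 5) (Seq (IfLt 11 7 (Const 7 1) (Const 7 2))
              (Seq (Put 7 6 7) (Seq (Put 8 8 6) (Succ 8 8))))))))))
        (Copy 8 7)))))
    (Seq (Get 7 7 9)
      (Seq (IfLt 2 7 skip (Seq (Put 7 9 11) (Seq (Put 8 8 9) (Succ 8 8))))
        (Succ 9 9))).

Definition orient_step :=
  Seq (Get 5 0 3) (Seq (Get 6 1 3) (Seq (Get 7 7 5)
    (Seq (IfLt 11 7 (emit 6 5) (emit 5 6)) (Succ 3 3)))).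

Definition spoke_step :=
  Seq (Get 7 7 3) (Seq (IfLt 11 7 (emit 3 0) (emit 0 3)) (Succ 3 3)).

(** Register 1 becomes the output length, so the edge count moves to register 10. Register 0 holds
    the number of the hub while spokes are written; the final increment makes it the vertex
    count. *)
Definition reduction : cmd :=
  Seq (Const 11 1) (Seq (WhileLt 3 1 build_step)
    (Seq (WhileLt 9 0 search_step)
      (Seq (Seq (Copy 10 1) (Seq (Const 1 0) (Const 3 0)))
        (Seq (WhileLt 3 10 orient_step)
          (Seq (Const 3 0) (Seq (WhileLt 3 0 spoke_step) (Succ 0 0))))))).

(** Comparing with register 11, which holds 1, separates the two colours. *)
Definition colour (c : bool) : nat := if c then 1 else 2.

Definition nat_spoke (n : nat) (b : pred nat) (v : nat) : nat * nat :=
  if b v then (n, v) else (v, n).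

(** * Correctness and running time of the reduction *)

Section ReductionRun.
Variables (n : nat) (e : seq (nat * nat)).

Definition adjacent (s : seq (nat * nat)) (u w : nat) : bool :=
  ((u, w) \in s) || ((w, u) \in s).

Record built i st L : Prop := Built {
  built_n : reg st 0 = n;
  built_m : reg st 1 = size e;
  built_0 : reg st 2 = 0;
  built_i : reg st 3 = i;
  built_sp : reg st 8 = 0;
  built_root : reg st 9 = 0;
  built_1 : reg st 11 = 1;
  built_in : forall j, (arr st 0 j, arr st 1 j) = nth (0, 0) e j;
  built_col : forall v, arr st 7 v = 0;
  built_adj : adj_lists st L;
  built_mem : forall v w, (w \in L v) = adjacent (take i e) v w;
  built_sum : \sum_(v < n) size (L v) = i.*2 }.

Hypothesis e_lt : forall p, p \in e -> p.1 < n /\ p.2 < n.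

Lemma build_stepP i st L : i < size e -> built i st L ->
  exists L', built i.+1 (eval build_step st) L'.
Proof.
move=> lt_i [rn rm r0 ri rsp rroot r1 inp col repL memL sumL].
pose p := nth (0, 0) e i.
have [eu ew] : arr st 0 i = p.1 /\ arr st 1 i = p.2 by rewrite /p -inp.
have [lt_u lt_w] : p.1 < n /\ p.2 < n by apply/e_lt/mem_nth.
exists (push (push L p.1 p.2) p.2 p.1).
split=> //=; rewrite ?ri //.
- have repL1 : adj_lists (eval (Seq (Get 5 0 3) (Get 6 1 3)) st) L by [].
  have := adj_lists_link (x := 6) (y := 5) isT isT isT
    (adj_lists_link (x := 5) (y := 6) isT isT isT repL1).
  by rewrite /= ri eu ew.
- move=> v w; rewrite (take_nth (0, 0)) // -/p /adjacent !mem_rcons !in_cons.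
  have := memL v w; rewrite /adjacent => memLvw.
  rewrite /push; case: {+}p => a b /=; rewrite !xpair_eqE.
  case: (v =P a) => _; case: (v =P b) => _;
  rewrite ?in_cons memLvw /= ?andbT ?andbF ?orbF //=;
  by case: (w == a) (w == b) (_ \in _) (_ \in _) => [] [] [] [].
- by rewrite !sum_push // sumL doubleS.
Qed.

(** [b] is a proper colouring extending the partial one in memory. By [search_complete] and
    [search_done], a neighbour of a coloured vertex off the stack is coloured. *)
Record searching (b : pred nat) L stk st : Prop := Searching {
  search_n : reg st 0 = n;
  search_m : reg st 1 = size e;
  search_0 : reg st 2 = 0;
  search_1 : reg st 11 = 1;
  search_in : forall j, (arr st 0 j, arr st 1 j) = nth (0, 0) e j;
  search_adj : adj_lists st L;
  search_sp : reg st 8 = size stk;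
  search_stk : stack_at (arr st 8) stk;
  search_stk_col : forall v, v \in stk -> v < n /\ arr st 7 v != 0;
  search_proper : forall u w, adjacent e u w -> b u != b w;
  search_col : forall v, arr st 7 v != 0 -> arr st 7 v = colour (b v);
  search_sound : forall v w, w \in L v -> adjacent e v w;
  search_complete : forall v w, adjacent e v w -> w \in L v \/ arr st 7 w != 0;
  search_done : forall v, arr st 7 v != 0 -> L v = [::] \/ v \in stk;
  search_root : forall v, v < reg st 9 -> arr st 7 v != 0;
  search_root_le : reg st 9 <= n }.

(** Potential of the search: scanning an entry or trying a root releases 2 and may push one vertex,
    at price 1; a pop releases 1. *)
Definition work L (stk : seq nat) st :=
  2 * \sum_(v < n) size (L v) + size stk + 2 * (n - reg st 9).

Lemma adjacent_lt u w : adjacent e u w -> w < n.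
Proof. by case/orP=> /e_lt[]. Qed.

Lemma search_pop b L v stk st : searching b L (v :: stk) st -> L v = [::] ->
  searching b L stk (eval search_step st) /\
  work L stk (eval search_step st) < work L (v :: stk) st.
Proof.
move=> [rn rm r0 r1 inp repL sp stk_a stk_c prop col snd cmp fin root root_le] Lv.
have [top stk_a'] := stk_a; have := repL v; rewrite Lv /= => p0.
rewrite /= r0 sp /= top p0 ltnn /= /work /=; split; last by lia.
split=> //=.
- by move=> u us; apply: stk_c; rewrite in_cons us orbT.
- move=> u cu; have [->|] := fin u cu; first by left.
  by rewrite in_cons => /predU1P[->|]; [left|right].
Qed.

(** The same [b] still works: it is proper, so the colour opposite to that of [v] is the one [b]
    assigns to [w]. *)
Lemma search_scan b L v w l stk st : searching b L (v :: stk) st -> L v = w :: l ->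
  let st' := eval search_step st in
  exists stk', searching b (pop L v) stk' st' /\
    work (pop L v) stk' st' < work L (v :: stk) st.
Proof.
move=> [rn rm r0 r1 inp repL sp stk_a stk_c prop col snd cmp fin root root_le] Lv.
have [top stk_a'] := stk_a.
have [lt_v cv] := stk_c v (mem_head v stk).
have adj_vw : adjacent e v w by apply: snd; rewrite Lv mem_head.
have lt_w := adjacent_lt adj_vw.
have := repL v; rewrite Lv /= => -[/andP[p0 pk] tw chl].
have sum_L := sum_pop lt_v Lv.
have pop_sub u x : x \in pop L v u -> x \in L u.
  by rewrite /pop; case: eqP => // ->; rewrite Lv; apply: mem_behead.
have repL' x : chain (reg st 12) (arr st 5) (arr st 6)
    (if x == v then arr st 5 (arr st 4 v) else arr st 4 x) (pop L v x).
  by rewrite /pop; case: eqP => [->|_]; [rewrite Lv | apply: repL].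
(* Only [w] leaves a list, and it is coloured afterwards. The colouring [c'] is the old one or its
   extension at [w]. *)
have cmp' (c' : nat -> nat) u x : (forall y, arr st 7 y != 0 -> c' y != 0) ->
    c' w != 0 -> adjacent e u x -> x \in pop L v u \/ c' x != 0.
  move=> ext cw /cmp[|/ext]; last by right.
  rewrite /pop; case: eqP => [->|]; last by left.
  by rewrite Lv in_cons => /predU1P[->|]; [right|left].
have fin' u (s : seq nat) : arr st 7 u != 0 -> {subset v :: stk <= s} ->
    pop L v u = [::] \/ u \in s.
  move=> cu sub; have [Lu|] := fin u cu; last by move/sub; right.
  by left; rewrite /pop Lu; case: ifP.
rewrite /= r0 sp /= top p0 /= tw.
have [cw|cw] := posnP (arr st 7 w); last first.
  exists (v :: stk); rewrite /work sum_L /=; split; last by lia.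
  split=> //=.
  - by move=> u x /pop_sub/snd.
  - by move=> u x; apply: cmp' => //; rewrite -lt0n.
  - by move=> u cu; apply: fin'.
have cb : (if 1 < colour (b v) then 1 else 2) = colour (b w).
  by have := prop _ _ adj_vw; case: (b v); case: (b w).
rewrite r1 (col _ cv) /= -/(colour _).
exists (w :: v :: stk).
have -> : forall x, (if 1 < colour (b v) then set_reg x 7 1 else set_reg x 7 2)
          = set_reg x 7 (colour (b w)).
  by move=> x; rewrite -cb; case: ifP.
rewrite /work sum_L /=; split; last by lia.
have ext u : arr st 7 u != 0 -> (if u == w then colour (b w) else arr st 7 u) != 0.
  by case: (u =P w) => // _; case: (b w).
split=> //=.
- by rewrite sp.
- by rewrite sp; apply: (@stack_at_push _ _ (v :: stk)).
- move=> u; rewrite in_cons => /predU1P[->|us].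
    by rewrite eqxx; split=> //; case: (b w).
  by have [lt_u cu] := stk_c u us; split=> //; apply: ext.
- by move=> u; case: (u =P w) => [-> //|_]; apply: col.
- by move=> u x /pop_sub/snd.
- move=> u x; apply: (cmp' (fun y => if y == w then colour (b w) else arr st 7 y) _ _ ext).
  by rewrite eqxx; case: (b w).
- move=> u; case: (u =P w) => [-> _|_ cu]; first by right; rewrite mem_head.
  by apply: fin' => // y ys; rewrite in_cons ys orbT.
- by move=> u /root/ext.
Qed.

(* With an empty stack the coloured vertices form a union of components, so the
   colouring of the others may be reversed to give the next root colour 1. *)
Lemma search_next b L st : searching b L [::] st -> reg st 9 < n ->
  let st' := eval search_step st in
  exists b' stk', searching b' L stk' st' /\
    work L stk' st' < work L [::] st.
Proof.
move=> [rn rm r0 r1 inp repL sp stk_a stk_c prop col snd cmp fin root root_le] lt_r.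
rewrite /= r0 sp /=.
have [cr|cr] := posnP (arr st 7 (reg st 9)); last first.
  exists b, [::]; rewrite /work /=; split; last by lia.
  split=> //= v; rewrite ltnS leq_eqVlt => /predU1P[->|/root //].
  by rewrite -lt0n.
rewrite r1 /=.
set r := reg st 9 in lt_r cr root *.
have closed u w : adjacent e u w -> arr st 7 u != 0 -> arr st 7 w != 0.
  move=> /cmp[wL|//] cu; have [Lu|//] := fin u cu.
  by rewrite Lu in wL.
pose flip := ~~ b r.
exists (fun v => if arr st 7 v == 0 then b v (+) flip else b v), [:: r].
have ext u : arr st 7 u != 0 -> (u == r) = false.
  by case: (u =P r) => // ->; rewrite cr.
rewrite /work /=; split; last by lia.
split=> //=.
- by move=> v; rewrite inE => /eqP->; rewrite eqxx.
- move=> u w adj_uw; have pr := prop _ _ adj_uw.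
  have adj_wu : adjacent e w u by rewrite /adjacent orbC.
  have := closed _ _ adj_uw; have := closed _ _ adj_wu.
  case: (arr st 7 u =P 0) => cu; case: (arr st 7 w =P 0) => cw /=.
  - by move: pr; case: (b u); case: (b w); case: flip.
  - by move=> /(_ isT).
  - by move=> _ /(_ isT).
  - by [].
- move=> v; case: (v =P r) => [-> _|_ cv]; first by rewrite cr /flip; case: (b r).
  by rewrite (negPf cv); apply: col.
- by move=> u w /cmp[|cw]; [left|right; rewrite ext].
- move=> v; case: (v =P r) => [-> _|_ cv]; first by right; rewrite mem_head.
  by have [|] := fin v cv; [left|].
- move=> v; rewrite ltnS leq_eqVlt => /predU1P[->|lt_v]; first by rewrite eqxx.
  by case: (v =P r) => // _; apply: root.
Qed.

Lemma search_stepP b L stk st : searching b L stk st -> reg st 9 < n ->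
  let st' := eval search_step st in
  exists b' L' stk', searching b' L' stk' st' /\
    work L' stk' st' < work L stk st.
Proof.
case: stk => [|v stk] inv lt_r.
  by have [b' [stk' ?]] := search_next inv lt_r; exists b', L, stk'.
case Lv: (L v) => [|w l].
  by exists b, L, stk; apply: search_pop.
by have [stk' ?] := search_scan inv Lv; exists b, (pop L v), stk'.
Qed.

(** Nothing is coloured yet, so any proper colouring extends the partial one. *)
Lemma searching_built (b : pred nat) st L :
  (forall u w, adjacent e u w -> b u != b w) ->
  built (size e) st L -> searching b L [::] st.
Proof.
move=> prop [rn rm r0 ri rsp rroot r1 inp col repL memL sumL].
rewrite take_size in memL.
split=> //; try by move=> v; rewrite col.
- by move=> v w; rewrite memL.
- by move=> v w; rewrite memL; left.
- by move=> v; rewrite rroot.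
- by rewrite rroot.
Qed.

(** * Writing the arcs of the digraph *)

Definition proper (b : pred nat) := forall p, p \in e -> b p.1 != b p.2.

(** Arcs overwrite the edge list in place: arc [i] goes into the cell just read, and [oriented_in]
    keeps the unread cells. *)
Record oriented b i st : Prop := Oriented {
  oriented_n : reg st 0 = n;
  oriented_i : reg st 3 = i;
  oriented_m : reg st 10 = size e;
  oriented_1 : reg st 11 = 1;
  oriented_col : forall v, v < n -> arr st 7 v = colour (b v);
  oriented_out : outputs st (map (orient b) (take i e));
  oriented_in : forall j, i <= j -> (arr st 0 j, arr st 1 j) = nth (0, 0) e j }.

Lemma orient_stepP b i st : i < size e -> oriented b i st ->
  oriented b i.+1 (eval orient_step st).
Proof.
move=> lt_i [rn ri rm r1 col out inp].
pose p := nth (0, 0) e i.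
have [eu ew] : arr st 0 i = p.1 /\ arr st 1 i = p.2 by rewrite /p -inp.
have [lt_u lt_w] : p.1 < n /\ p.2 < n by apply/e_lt/mem_nth.
pose st1 := eval (Seq (Get 5 0 3) (Seq (Get 6 1 3) (Get 7 7 5))) st.
have out1 : outputs st1 (map (orient b) (take i e)) by [].
have r1i : reg st 1 = i by rewrite out.1 size_map size_takel // ltnW.
have [r5 r6] : reg st1 5 = p.1 /\ reg st1 6 = p.2 by rewrite /= ri eu ew.
have test : (reg st1 11 < reg st1 7) = ~~ b p.1.
  by rewrite /= ri eu r1 col //; case: (b p.1).
(* The step is split at its branch so that [outputs_emit] applies on either side. *)
have -> : eval orient_step st = eval (Succ 3 3)
    (if reg st1 11 < reg st1 7 then eval (emit 6 5) st1 else eval (emit 5 6) st1).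
  by [].
rewrite test.
have mapS : map (orient b) (take i.+1 e) =
    rcons (map (orient b) (take i e)) (if b p.1 then p else (p.2, p.1)).
  by rewrite (take_nth (0, 0)) // map_rcons.
have kept j (x y : nat) : i < j ->
    (if j == reg st 1 then x else arr st 0 j, if j == reg st 1 then y else arr st 1 j)
    = nth (0, 0) e j.
  by move=> lt_ij; rewrite r1i gtn_eqF // inp // ltnW.
have := outputs_emit 5 6 out1; have := outputs_emit 6 5 out1.
rewrite r5 r6 -surjective_pairing => out65 out56.
case: (b p.1) mapS => mapS; split; rewrite ?mapS //; try by rewrite /= ri.
- by move=> j /kept; apply.
- by move=> j /kept; apply.
Qed.

Record spoked b i st : Prop := Spoked {
  spoked_n : reg st 0 = n;
  spoked_i : reg st 3 = i;
  spoked_1 : reg st 11 = 1;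
  spoked_col : forall v, v < n -> arr st 7 v = colour (b v);
  spoked_out :
    outputs st (map (orient b) e ++ map (nat_spoke n b) (iota 0 i)) }.

Lemma spoke_stepP b i st : i < n -> spoked b i st ->
  spoked b i.+1 (eval spoke_step st).
Proof.
move=> lt_i [rn ri r1 col out].
pose st1 := eval (Get 7 7 3) st.
have := outputs_emit (st := st1) 0 3 out; have := outputs_emit (st := st1) 3 0 out.
rewrite [reg st1 0]rn [reg st1 3]ri => out30 out03.
have test : (reg st1 11 < reg st1 7) = ~~ b i.
  by rewrite /= ri r1 col //; case: (b i).
have -> : eval spoke_step st = eval (Succ 3 3)
    (if reg st1 11 < reg st1 7 then eval (emit 3 0) st1 else eval (emit 0 3) st1).
  by [].
rewrite test.
have outS : map (orient b) e ++ map (nat_spoke n b) (iota 0 i.+1) =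
    rcons (map (orient b) e ++ map (nat_spoke n b) (iota 0 i))
      (if b i then (n, i) else (i, n)).
  by rewrite -addn1 iotaD map_cat catA cats1.
by case: (b i) outS => outS; split; rewrite ?outS //= ri.
Qed.

(** The initial potential: each edge lies in two adjacency lists, the stack is empty and all [n]
    roots remain. *)
Definition work_bound := 2 * (size e).*2 + 2 * n.

Lemma reduction_run : (exists b, proper b) ->
  run reduction (init n e [::]) (200 * (n + size e).+1)
    (fun st => reg st 0 = n.+1 /\ exists2 b, proper b &
       outputs st (map (orient b) e ++ map (nat_spoke n b) (iota 0 n))).
Proof.
move=> [b0 prop0].
have adj0 u w : adjacent e u w -> b0 u != b0 w.
  by case/orP=> /prop0 //=; rewrite eq_sym.
(* One summand per phase, in program order; the sum is linear and 200 dominates its coefficients. *)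
apply: (@run_weaken _ _
  (1 + ((size e * (cost build_step).+1).+1 +
   ((work_bound * (cost search_step).+1).+1 + (3 +
   ((size e * (cost orient_step).+1).+1 + (1 +
   ((n * (cost spoke_step).+1).+1 + 1))))))) _ _ _ _ _ (fun _ => id)); last first.
  by rewrite /work_bound /=; lia.
apply: (run_seq (Q1 := fun st => exists L, built 0 st L)).
  apply: run_eval => //; exists (fun _ => [::]); split=> //=.
  - by move=> j; rewrite -surjective_pairing.
  - by move=> v w; rewrite take0.
  - by rewrite big1.
move=> st0 built0.
apply: (run_seq (Q1 := fun st => exists L, built (size e) st L)).
  apply: (run_for (J := fun i st => exists L, built i st L)) built0 => //.
    by move=> i st [L inv]; rewrite (built_i inv) (built_m inv).
  by move=> i st lt_i [L]; apply: build_stepP.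
move=> st1 [L1 built1].
(* Colouring, lists and stack vary from step to step, so they are hidden and only the potential is
   exposed. *)
pose I k st := exists b L stk, searching b L stk st /\ work L stk st = k.
apply: (run_seq (Q1 := fun st => n <= reg st 9 /\ exists k, I k st)).
  have I1 : I work_bound st1.
    exists b0, L1, [::]; split; first exact: searching_built.
    by rewrite /work (built_sum built1) (built_root built1) subn0 addn0.
  apply: run_weaken (run_while _ _ I1) (leqnn _) _ => //.
    move=> k st [b [L [stk [inv <-]]]]; rewrite (search_n inv) => lt_r.
    have [b' [L' [stk' [inv' lt_work]]]] := search_stepP inv lt_r.
    by exists (work L' stk' (eval search_step st)) => //; exists b', L', stk'.
  move=> st [le_n [k [b [L [stk [inv _]]]]]].
  by move: le_n; rewrite (search_n inv); split=> //; exists (work L stk st), b, L, stk.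
move=> st2 [le_n [_ [b [L [stk [inv _]]]]]].
(* The root index has reached [n], so every vertex is coloured, even if the stack is not empty. *)
have col v : v < n -> arr st2 7 v = colour (b v).
  by move=> lt_v; apply/(search_col inv)/(search_root inv)/(leq_trans lt_v).
have propb : proper b.
  by move=> [u w] uwe; apply: (search_proper inv); rewrite /adjacent uwe.
apply: (run_seq (Q1 := oriented b 0)).
  apply: run_eval => //; split=> //=; try by case: inv.
  by rewrite take0.
move=> st3 oriented0.
apply: (run_seq (Q1 := oriented b (size e))).
  apply: run_for oriented0 => //; last exact: orient_stepP.
  by move=> i st [].
move=> st4 [rn _ _ r1 col4 out4 _]; rewrite take_size in out4.
apply: (run_seq (Q1 := spoked b 0)).
  by apply: run_eval => //; split=> //=; rewrite cats0.
move=> st5 spoked0.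
apply: (run_seq (Q1 := spoked b n)).
  apply: run_for spoked0 => //; last exact: spoke_stepP.
  by move=> i st [].
move=> st6 [rn6 _ _ _ out6]; apply: run_eval => //.
by split; [rewrite /= rn6 | exists b].
Qed.

End ReductionRun.

(** * Recovering an edge cover from a spanning subgraph *)

Definition recovery_step :=
  Seq (Get 5 2 3) (Seq (Get 6 3 3)
    (Seq (IfLt 5 0 (IfLt 6 0 (emit 5 6) skip) skip) (Succ 3 3))).

Definition recovery : cmd :=
  Seq (Seq (Const 1 0) (Const 3 0)) (WhileLt 3 2 recovery_step).

(** The hub has number [n], so this selects the arcs that avoid it. *)
Definition below n (p : nat * nat) := (p.1 < n) && (p.2 < n).

(** Arcs are read from arrays 2 and 3 and written to arrays 0 and 1, so the whole input list
    survives. *)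
Record recovered n (l : seq (nat * nat)) i st : Prop := Recovered {
  recovered_n : reg st 0 = n;
  recovered_i : reg st 3 = i;
  recovered_m : reg st 2 = size l;
  recovered_in : forall j, (arr st 2 j, arr st 3 j) = nth (0, 0) l j;
  recovered_out : outputs st [seq p <- take i l | below n p] }.

Lemma recovery_stepP n l i st : i < size l -> recovered n l i st ->
  recovered n l i.+1 (eval recovery_step st).
Proof.
move=> lt_i [rn ri rm inp out].
pose p := nth (0, 0) l i.
have [eu ew] : arr st 2 i = p.1 /\ arr st 3 i = p.2 by rewrite /p -inp.
pose st1 := eval (Seq (Get 5 2 3) (Get 6 3 3)) st.
have [r5 r6] : reg st1 5 = p.1 /\ reg st1 6 = p.2 by rewrite /= ri eu ew.
have -> : eval recovery_step st = eval (Succ 3 3)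
    (if below n p then eval (emit 5 6) st1 else eval skip st1).
  by rewrite /below -r5 -r6 -[n]rn /=; case: ifP => //; case: ifP.
have := outputs_emit (st := st1) 5 6 out.
rewrite r5 r6 -surjective_pairing => out56.
have outS : [seq q <- take i.+1 l | below n q] =
    if below n p then rcons [seq q <- take i l | below n q] p
    else [seq q <- take i l | below n q].
  by rewrite (take_nth (0, 0)) // filter_rcons.
by case: (below n p) outS => outS; split; rewrite ?outS //= ri.
Qed.

Lemma recovery_run n e l : run recovery (init n e l) (30 * (size l).+1)
  (fun st => outputs st [seq p <- l | below n p]).
Proof.
apply: (@run_weaken _ _ (2 + (size l * (cost recovery_step).+1).+1)
  _ (recovered n l (size l))); first last.
- by move=> st [_ _ _ _]; rewrite take_size.
- by rewrite /=; lia.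
apply: (run_seq (Q1 := recovered n l 0)).
  apply: run_eval => //; split=> //=; last by rewrite take0.
  by move=> j; rewrite -surjective_pairing.
move=> st0 recovered0; apply: run_for recovered0 => //.
  by move=> i st [].
by move=> i st; apply: recovery_stepP.
Qed.

(** * From lists of numbers back to graphs *)

Section Transfer.
Variables (n : nat) (E : {set {set 'I_n}}) (s : seq ('I_n * 'I_n)).

Lemma code_lt (l : seq ('I_n * 'I_n)) p : p \in code l -> p.1 < n /\ p.2 < n.
Proof. by case/mapP=> q _ ->; split; apply: ltn_ord. Qed.

Lemma bipartite_proper :
  bipartite E -> edge_list E s -> exists b, proper (code s) b.
Proof.
move=> [U bipE] [_ def_E].
(* Colours are defined on all of [nat]; the default [false] is never met on codes of vertices. *)
exists (fun k => if insub k is Some u then u \in U else false).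
move=> _ /mapP[p ps ->] /=; rewrite !valK.
have [|u [w [uU wU eq_e]]] := bipE [set p.1; p.2].
  by rewrite def_E inE; apply: (map_f (fun q => [set q.1; q.2])).
have: u \in [set p.1; p.2] by rewrite eq_e set21.
have: w \in [set p.1; p.2] by rewrite eq_e set22.
rewrite !in_set2 => /orP[]/eqP ew /orP[]/eqP eu; move: uU wU; rewrite eu ew.
- by move=> ->.
- by move=> -> /negPf->.
- by move=> -> /negPf->.
- by move=> ->.
Qed.

Lemma proper_bicoloured (b : pred nat) : edge_list E s ->
  proper (code s) b -> bicoloured (fun v : 'I_n => b v) E.
Proof.
move=> [_ def_E] propb e; rewrite def_E inE => /mapP[p ps ->].
have := propb _ (map_f _ ps); rewrite /forward /=.
case b1: (b p.1); case b2: (b p.2) => // _; first by exists p; rewrite ?b1 ?b2.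
by exists (p.2, p.1); rewrite ?b1 ?b2 // /ends setUC.
Qed.

Lemma val_emb (p : 'I_n * 'I_n) :
  (val (emb p).1, val (emb p).2) = (val p.1, val p.2).
Proof. by congr (_, _); apply: lift_max. Qed.

Lemma val_spoke (b : pred nat) (v : 'I_n) (q := spoke (fun u : 'I_n => b u) v) :
  (val q.1, val q.2) = nat_spoke n b v.
Proof.
by rewrite /q /spoke /nat_spoke; case: (b v); congr (_, _); apply: lift_max.
Qed.

Lemma code_cover_arcs (b : pred nat) :
  code (map (@emb n) (map (orient (fun v : 'I_n => b v)) s)
        ++ map (spoke (fun v : 'I_n => b v)) (enum 'I_n))
  = map (orient b) (code s) ++ map (nat_spoke n b) (iota 0 n).
Proof.
rewrite /code map_cat -val_enum_ord -!map_comp.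
congr (_ ++ _); apply: eq_map; last exact: val_spoke.
move=> p; apply: etrans (val_emb _) _.
by case: p => u w; rewrite /orient /=; case: (b u).
Qed.

Lemma below_unemb (q : 'I_n.+1 * 'I_n.+1) :
  below n (val q.1, val q.2) = unemb q :> bool.
Proof.
case def_q: (unemb q) => [p|].
  have := unembK q; rewrite def_q /= => <-.
  by rewrite val_emb /below /= !ltn_ord.
apply/negbTE; move: def_q; rewrite /unemb /below.
case: unliftP => [u eq1|->]; last by rewrite ltnn.
by case: unliftP => [w eq2|->]; last by rewrite ltnn andbF.
Qed.

Lemma code_unemb (l : seq ('I_n.+1 * 'I_n.+1)) :
  code (pmap (@unemb n) l) = [seq p <- code l | below n p].
Proof.
elim: l => //= q l IH; rewrite below_unemb -IH.
case def_q: (unemb q) => [p|] //=.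
by have := unembK q; rewrite def_q /= => <-; rewrite val_emb.
Qed.

Lemma card_edge_list : edge_list E s -> #|E| = size s.
Proof.
by move=> [uniq_s ->]; rewrite cardsE (card_uniqP uniq_s) size_map.
Qed.

End Transfer.

(** * Assembling the digraph, the correspondence and the two programs *)

Theorem theorem2 :
  exists (P Q : cmd) (c : nat),
  forall (n : nat) (E : {set {set 'I_n}}) (s : seq ('I_n * 'I_n)),
  bipartite E -> edge_list E s ->
  exists (N : nat) (A : {set 'I_N * 'I_N}) (k : nat)
         (f : {set {set 'I_n}} -> {set 'I_N * 'I_N})
         (g : {set 'I_N * 'I_N} -> {set {set 'I_n}}),
    (* P constructs the digraph D = ('I_N, A) from B = ('I_n, E) *)
    (exists (st : state) (a : seq ('I_N * 'I_N)),
       [/\ exec_within P (init n (code s) [::]) st (c * (n + size s).+1),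
           reg st 0 = N, outputs st (code a) & arc_list A a]) /\
    (* D is an instance of SCSS_3 *)
    [/\ loopless A, cycles_le 3 A &
        (exists C, edge_cover E C) -> strongly_connected A] /\
    (* edge covers of B and SCSSs of D correspond, up to the constant k *)
    (forall C, edge_cover E C ->
       [/\ scss A (f C), #|f C| = #|C| + k & g (f C) = C]) /\
    (forall S, scss A S ->
       [/\ edge_cover E (g S), #|S| = #|g S| + k & f (g S) = S]) /\
    (forall S, min_scss A S -> min_edge_cover E (g S)) /\
    (* Q recovers the edge cover g S from B and the SCSS S *)
    (forall S l, scss A S -> arc_list S l ->
       exists (st : state) (b : seq ('I_n * 'I_n)),
       [/\ exec_within Q (init n (code s) (code l)) st (c * (n + size s).+1),
           outputs st (code b) & edge_list (g S) b]).
Proof.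
exists reduction, recovery, 200 => n E s bipE listE.
have [st [t run_t le_t] [rn [b propb out]]] :=
  reduction_run (@code_lt n s) (bipartite_proper bipE listE).
rewrite size_map in le_t.
pose bv := fun v : 'I_n => b v.
have colE : bicoloured bv E := proper_bicoloured listE propb.
(* The colouring is the one found by the program, not the given bipartition; the additive constant
   counts the spokes. *)
exists n.+1, (cover_arcs bv E), n, (cover_arcs bv), (arc_edges bv).
split; [|split; [|split; [|split; [|split]]]].
- exists st, (map (@emb n) (map (orient bv) s) ++ map (spoke bv) (enum 'I_n)).
  split=> //; first by exists t.
    by rewrite code_cover_arcs.
  apply: arc_list_cover_arcs => // p ps; exact: propb (map_f _ ps).
- split; [exact: cover_arcs_loopless | exact: cover_arcs_cycles |].
  move=> [C covC]; have [sub scC] := cover_scss colE covC => u v.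
  apply: connect_sub (scC u v) => x y xy; apply: connect1.
  exact: (subsetP sub).
- move=> C covC; split; [exact: cover_scss | |].
    exact: card_cover_arcs covC.1.
  exact: cover_arcsK covC.1.
- move=> S sS; have covS := scss_edge_cover sS.
  split=> //; last exact: arc_edgesK sS.
  by rewrite -(card_cover_arcs colE covS.1) (arc_edgesK sS).
- by move=> S; apply: min_scss_edge_cover colE _.
- move=> S l sS listS; have [st' [t' run_t' le_t'] out'] := recovery_run n (code s) (code l).
  exists st', (pmap (@unemb n) l); split; last exact: arc_edges_list sS listS.
    exists t' => //; apply: leq_trans le_t' _.
    (* The arcs of [S] are among the [size s + n] arcs of the digraph, so time linear in [size l] is
       linear in the size of the bipartite graph. *)
    have size_l : size l <= size s + n.
      have -> : size l = #|S|.
        by have [uniq_l ->] := listS; rewrite cardsE (card_uniqP uniq_l).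
      by rewrite -(card_edge_list listE) -(card_cover_arcs colE) ?subset_leq_card ?sS.1.
    apply: (@leq_trans (30 * (size s + n).+1)); last by lia.
    by rewrite size_map leq_mul2l ltnS size_l.
  by rewrite code_unemb.
Qed.
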